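(* Let $S = L_3(2) = \mathrm{SL}(3,2)$. Then the following hold. (a) $\sigma(S) = 1/4$, and for $s \in S^\times$ one has $\sigma(S,s) = 1/4$ exactly when $s$ has order $7$. (b) For $s \in S$ of order $7$, $\mathcal{M}(S,s)$ consists of one group of the type $7:3$ (the nonabelian group of order $21$). (c) $P(S) = 1/4$, and for $s \in S^\times$ one has $P(S,s) = 1/4$ exactly when $s$ has order $7$. (d) The uniform spread of $S$ is exactly three, where the class can be taken to consist of elements $s$ of order $7$, and the spread of $S$ is exactly four.
   Context: For a finite nonabelian simple group $S$ let $S^\times = S \setminus \{1\}$. For $s \in S^\times$, $\mathcal{M}(S,s)$ is the set of all maximal subgroups of $S$ containing $s$. For $M \le S$, $1_M^S$ is the permutation character of $S$ on the right cosets of $M$. For $g \in S^\times$ set $\sigma(g,s) = \sum_{M \in \mathcal{M}(S,s)} 1_M^S(g)/1_M^S(1)$, $\sigma(S,s) = \max\{\sigma(g,s) : g \in S^\times\}$, $\sigma(S) = \min\{\sigma(S,s) : s \in S^\times\}$. Further $P(g,s) = |\{h \in S : \langle s^h, g\rangle \neq S\}|/|S|$, $P(S,s) = \max\{P(g,s) : g \in S^\times\}$, $P(S) = \min\{P(S,s) : s \in S^\times\}$. $S$ has spread at least $k$ if for any $g_1,\ldots,g_k \in S^\times$ there is $s \in S$ with $\langle g_i, s\rangle = S$ for $1 \le i \le k$; it has uniform spread at least $k$ if there is a fixed conjugacy class $C$ of $S$ such that $s$ can always be chosen in $C$. The (uniform) spread is exactly $k$ if it is at least $k$ but not at least $k+1$.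 *)

(* Defs.v *)
From mathcomp Require Import all_boot all_order all_algebra.
From mathcomp Require Import all_fingroup all_solvable.

Set Implicit Arguments.
Unset Strict Implicit.
Unset Printing Implicit Defensive.

Import Order.TTheory GRing.Theory Num.Theory GroupScope.
Local Open Scope ring_scope.

Section SpecialLinear.

Variables (n : nat) (R : finComUnitRingType).

Definition SLgroup : {set {'GL_n[R]}} :=
  [set u : {'GL_n[R]} | \det (GLval u) == 1].

Fact SLgroup_set : group_set SLgroup.
Proof.
apply/group_setP; split=> [|u v]; first by rewrite inE GL_1E det1.
by rewrite !inE GL_MxE det_mulmx => /eqP-> /eqP->; rewrite mulr1.
Qed.

Canonical SLgroup_group := Group SLgroup_set.

End SpecialLinear.

(* L_3(2) = PSL(3,2) is SL(3,2), since 1 is the only cube root of 1 in F_2. *)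
Definition L32 : {group {'GL_3(2)}} := SLgroup_group 3 'F_2.

Section Generation.

Variable gT : finGroupType.
Implicit Types (A C : {set gT}) (S M : {group gT}) (g s : gT).

(* Maximum and minimum of F over a nonempty A with 1 \notin A: the default
   value of the big operator is then F (repr A), with repr A \in A, so it is
   itself one of the values of F on A. *)
Definition max_over A (F : gT -> rat) : rat :=
  \big[Num.max/F (repr A)]_(x in A) F x.

Definition min_over A (F : gT -> rat) : rat :=
  \big[Num.min/F (repr A)]_(x in A) F x.

Definition maximals S s : {set {group gT}} :=
  [set M : {group gT} | maximal M S & s \in M].

(* The permutation character 1_M^S: number of right cosets of M in S that are
   fixed by g acting by right translation. *)
Definition perm_char S M g : rat := #|'Fix_(rcosets M S | 'Rs)[g]|%:R.

Definition sigma_gs S g s : rat :=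
  \sum_(M in maximals S s) perm_char S M g / perm_char S M 1%g.

Definition sigma_s S s : rat := max_over S^# (fun g => sigma_gs S g s).

Definition sigma S : rat := min_over S^# (sigma_s S).

Definition P_gs S g s : rat :=
  #|[set h in S | <<[set s ^ h; g]>>%g != S]|%:R / #|S|%:R.

Definition P_s S s : rat := max_over S^# (fun g => P_gs S g s).

Definition P S : rat := min_over S^# (P_s S).

(* The g_i need not be distinct. *)
Definition spread_from S A k : Prop :=
  forall g : 'I_k -> gT, (forall i, g i \in S^#) ->
  exists2 s, s \in A & forall i, <<[set g i; s]>>%g = S.

Definition spread_ge S k : Prop := spread_from S S k.

Definition uniform_spread_ge S k : Prop :=
  exists2 C, C \in classes S & spread_from S C k.

Definition spread_eq S k : Prop := spread_ge S k /\ ~ spread_ge S k.+1.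

Definition uniform_spread_eq S k : Prop :=
  uniform_spread_ge S k /\ ~ uniform_spread_ge S k.+1.

(* The nonabelian group 7:3 of order 21. *)
Definition type_7_3 M : Prop :=
  exists N H : {group gT},
    [/\ (N ><| H)%g = M, #|N| = 7%N, #|H| = 3%N & ~~ abelian M].

End Generation.

(* Main.v *)
Require Import Defs.
From mathcomp Require Import all_boot all_order all_algebra.
From mathcomp Require Import all_fingroup all_solvable.
From mathcomp Require Import ring lra.

Set Implicit Arguments.
Unset Strict Implicit.
Unset Printing Implicit Defensive.

Import Order.TTheory GRing.Theory Num.Theory GroupScope.
Local Open Scope ring_scope.

(* A subgroup of L_3(2) containing s of order 7 and an element outside the
   normalizer N of <s> also contains elements of orders 3 and 4; its order is
   then divisible by 84, and there is no subgroup of index 2.  So N, of order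
   21, is the only maximal subgroup containing s, and g fails to generate with
   a conjugate of s iff it normalizes the corresponding one of the 8 Sylow
   7-subgroups.  An element of order 3 normalizes two of them, any other
   nontrivial element at most one: this gives 1/4 in (a) and (c), and spread at
   least 3 for the class of s.  An element not of order 7 fixes a point of the
   Fano plane, and the axis of a transvection contains 3 of the 7 points, so
   that sigma and P are at least 3/7 there.

   For spread at least 4, if some g_i does not have order 3, then at most
   1 + 2 * 3 < 8 Sylow 7-subgroups are excluded.  Otherwise each g_i fixes one
   point and one line, and among the remaining 3 or more points and 3 or more
   lines there is a flag; an element of order 4 fixing that flag and no other
   point or line generates with every g_i.  Conversely, four elements of order
   3 can between them normalize all 8 Sylow 7-subgroups, and for a suitable
   transvection t each element not of order 7 shares a fixed point with t or
   one of these four.  Three transvections with concurrent axes cover all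
   points, which excludes the classes of elements not of order 7 for uniform
   spread.

   The finite verifications are carried out on 3x3 matrices of booleans, which
   act on row vectors from the right. *)

(** * Extrema over a set *)

Section BigOpBounds.

Variables (gT : finGroupType) (A : {set gT}) (F : gT -> rat).

Lemma max_over_ge x : x \in A -> F x <= max_over A F.
Proof. exact: le_bigmax_cond. Qed.

Lemma max_over_eq x c :
  x \in A -> F x = c -> {in A, forall y, F y <= c} -> max_over A F = c.
Proof.
move=> Ax Fx Fle; apply/eqP; rewrite eq_le -{2}Fx max_over_ge // andbT.
(* The default value [F (repr A)] has to obey the bound too; [x] shows that [repr A] lies in [A]. *)
by apply: bigmax_le => //; apply/Fle/mem_repr/Ax.
Qed.

Lemma min_over_eq x c :
  x \in A -> F x = c -> {in A, forall y, c <= F y} -> min_over A F = c.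
Proof.
move=> Ax Fx Fge; apply/eqP; rewrite eq_le -{1}Fx; apply/andP; split.
  exact: bigmin_le_cond.
by apply: le_bigmin => //; apply/Fge/mem_repr/Ax.
Qed.

End BigOpBounds.

Lemma card_bigcup_leq (I T : finType) (P : pred I) (B : I -> {set T}) :
  (#|\bigcup_(i | P i) B i| <= \sum_(i | P i) #|B i|)%N.
Proof.
elim/big_rec2: _ => [|i n C _ leCn]; first by rewrite cards0.
by rewrite (leq_trans (leq_card_setU _ _)) // leq_add2l.
Qed.

(** * Fixed cosets and failure of generation *)

Section Fixity.

Variables (gT : finGroupType) (S : {group gT}).
Implicit Types (M : {group gT}) (g s h : gT).

(* h is in conj_into M g iff g fixes the coset Mh. *)
Definition conj_into M g : {set gT} := [set h in S | (g ^ h^-1)%g \in M].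

Definition bad_conj g s : {set gT} := [set h in S | <<[set (s ^ h)%g; g]>>%g != S].

(** The cosets fixed by [g] partition [conj_into M g], and each has [#|M|] elements. *)
Lemma card_conj_into M g : M \subset S ->
  #|conj_into M g| = (#|'Fix_(rcosets M S | 'Rs)[g]| * #|M|)%N.
Proof.
move=> sMS; pose Q := 'Fix_(rcosets M S | 'Rs)[g].
have [/eqP coverS tiS n0S] := and3P (rcosets_partition sMS).
have sQ : Q \subset rcosets M S by apply: subsetIl.
have partQ : partition Q (cover Q).
  apply/and3P; split=> //; first exact: trivIsetS tiS.
  by apply: contra n0S; apply: (subsetP sQ).
have cardQ : {in Q, forall C : {set gT}, #|C| = #|M|}.
  by move=> C /(subsetP sQ)/rcosetsP[x _ ->]; rewrite card_rcoset.
rewrite -(card_uniform_partition cardQ partQ); apply: eq_card => h.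
have fixE x : x \in S -> ((M :* x)%g \in Q) = ((g ^ x^-1)%g \in M).
  move=> Sx; rewrite inE sub_afixRs_norms sub1set mem_conjg andbC.
  by rewrite -rcosetE imset_f ?andbT.
rewrite inE; apply/andP/bigcupP=> [[Sh Mgh] | [C QC Ch]].
  by exists (M :* h)%g; rewrite ?fixE ?rcoset_refl.
have [x Sx defC] := rcosetsP (subsetP sQ _ QC).
rewrite {}defC in QC Ch; have Sh : h \in S.
  by case/rcosetP: Ch => m /(subsetP sMS) Sm ->; rewrite groupM.
by rewrite -fixE // (rcoset_eqP Ch).
Qed.

(** The identity fixes every coset, so the factor [#|M|] cancels. *)
Lemma perm_char_ratio M g : M \subset S ->
  perm_char S M g / perm_char S M 1%g = #|conj_into M g|%:R / #|S|%:R.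
Proof.
move=> sMS; have cardS : #|S| = (#|'Fix_(rcosets M S | 'Rs)[1%g]| * #|M|)%N.
  rewrite -card_conj_into //; apply: eq_card => h.
  by rewrite inE conj1g group1 andbT.
rewrite /perm_char cardS card_conj_into // !natrM -[RHS]mulf_div divff ?mulr1 //.
by rewrite pnatr_eq0 -lt0n cardG_gt0.
Qed.

(** If [s ^ h] and [g] lie in a maximal subgroup [H], then the conjugate of [H] by [h^-1] is maximal
    and contains [s] and [g ^ h^-1]. *)
Lemma bad_conj_sub g s : g \in S -> s \in S ->
  bad_conj g s \subset \bigcup_(M in maximals S s) conj_into M g.
Proof.
move=> Sg Ss; apply/subsetP=> h; rewrite inE => /andP[Sh ngen].
have : <<[set (s ^ h)%g; g]>>%G \subset S.
  by rewrite gen_subG subUset !sub1set groupJ.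
case/maximal_exists=> [eqS | [H maxH sKH]].
  by rewrite -val_eqE /= eqS eqxx in ngen.
have [Hsh Hg] : (s ^ h)%g \in H /\ g \in H.
  by split; apply: (subsetP sKH); rewrite mem_gen // !inE eqxx ?orbT.
apply/bigcupP; exists (H :^ h^-1)%G; rewrite inE /=.
  by rewrite -(conjGid (groupVr Sh)) maximalJ maxH mem_conjgV.
by rewrite Sh memJ_conjg.
Qed.

(** A union bound over the maximal subgroups. It carries lower bounds for P over to sigma. *)
Lemma P_gs_le_sigma_gs g s : g \in S -> s \in S -> P_gs S g s <= sigma_gs S g s.
Proof.
move=> Sg Ss; rewrite /P_gs /sigma_gs -/(bad_conj g s).
under eq_bigr => M /[!inE] /andP[/maxgroupp/andP[sMS _] _].
  rewrite perm_char_ratio //; over.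
rewrite -mulr_suml ler_pM2r ?invr_gt0 ?ltr0n ?cardG_gt0 //.
rewrite -natr_sum ler_nat (leq_trans _ (card_bigcup_leq _ (fun M => conj_into M g))) //.
by rewrite subset_leq_card ?bad_conj_sub.
Qed.

Lemma sigma_gs_maximals1 M g s : maximals S s = [set M] ->
  sigma_gs S g s = #|conj_into M g|%:R / #|S|%:R.
Proof.
move=> defM; rewrite /sigma_gs defM big_set1 perm_char_ratio //.
have: M \in maximals S s by rewrite defM set11.
by rewrite inE => /andP[/maxgroupp/andP[]].
Qed.

(** With a single maximal subgroup the union bound is sharp: [s ^ h] and [g] both lie in the proper
    subgroup [M :^ h]. *)
Lemma bad_conj_maximals1 M g s : maximals S s = [set M] ->
  g \in S -> s \in S -> bad_conj g s = conj_into M g.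
Proof.
move=> defM Sg Ss; apply/eqP; rewrite eqEsubset.
have := bad_conj_sub Sg Ss; rewrite defM big_set1 => -> /=.
have: M \in maximals S s by rewrite defM set11.
rewrite inE => /andP[/maxgroupp prM Ms].
apply/subsetP=> h; rewrite !inE => /andP[Sh Mg]; rewrite Sh /=.
apply: contraTneq prM => genS; rewrite properE negb_and negbK.
apply/orP; right; rewrite -(conjSg S M h) conjGid // -{1}genS gen_subG subUset !sub1set.
by rewrite memJ_conjg Ms mem_conjg Mg.
Qed.

Lemma conj_generates k (g : 'I_k -> gT) s :
  (\sum_i #|bad_conj (g i) s| < #|S|)%N ->
  exists2 h, h \in S & forall i, <<[set g i; (s ^ h)%g]>>%g = S.
Proof.
move=> ltS; have [h Sh nbad] : exists2 h, h \in S & h \notin \bigcup_i bad_conj (g i) s.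
  apply/subsetPn; apply: contraL ltS => /subset_leq_card leS.
  by rewrite -leqNgt (leq_trans leS) ?card_bigcup_leq.
exists h => // i; apply/eqP; apply: contraR nbad => ngen.
by apply/bigcupP; exists i; rewrite // inE Sh setUC.
Qed.

End Fixity.

(** * The boolean model *)

Definition v3 : Type := bool * bool * bool.
Definition m3 : Type := v3 * v3 * v3.

Definition veq (v w : v3) : bool :=
  let: (a, b, c) := v in let: (a', b', c') := w in
  [&& eqb a a', eqb b b' & eqb c c'].

Definition meq (x y : m3) : bool :=
  let: (a, b, c) := x in let: (a', b', c') := y in
  [&& veq a a', veq b b' & veq c c'].

Definition vmul (v : v3) (x : m3) : v3 :=
  let: (a, b, c) := v in
  let: ((x00, x01, x02), (x10, x11, x12), (x20, x21, x22)) := x in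
  (a && x00 (+) b && x10 (+) c && x20,
   a && x01 (+) b && x11 (+) c && x21,
   a && x02 (+) b && x12 (+) c && x22).

Definition mmul (x y : m3) : m3 :=
  let: (a, b, c) := x in (vmul a y, vmul b y, vmul c y).

Definition tr3 (x : m3) : m3 :=
  let: ((x00, x01, x02), (x10, x11, x12), (x20, x21, x22)) := x in
  ((x00, x10, x20), (x01, x11, x21), (x02, x12, x22)).

(* The adjugate; it is the inverse because all determinants are 1. *)
Definition minv (x : m3) : m3 :=
  let: ((a, b, c), (d, e, f), (g, h, i)) := x in
  ((e && i (+) f && h, b && i (+) c && h, b && f (+) c && e),
   (d && i (+) f && g, a && i (+) c && g, a && f (+) c && d),
   (d && h (+) e && g, a && h (+) b && g, a && e (+) b && d)).

Definition mat1 : m3 :=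
  ((true, false, false), (false, true, false), (false, false, true)).

Fixpoint mexp (x : m3) (n : nat) : m3 :=
  if n is n'.+1 then mmul x (mexp x n') else mat1.

Definition v0 : v3 := (false, false, false).

Definition points : seq v3 :=
  [:: (true, false, false); (false, true, false); (false, false, true);
      (true, true, false); (true, false, true); (false, true, true);
      (true, true, true)].

Definition mats : seq m3 :=
  [seq (r, t) | r <- [seq (r, t) | r <- v0 :: points, t <- v0 :: points],
                t <- v0 :: points].

(** Invertibility is tested as having no nonzero row vector in the kernel. *)
Definition gl3 : seq m3 :=
  [seq x <- mats | all (fun v => ~~ veq (vmul v x) v0) points].

(** This says that [x] has order [p] when [p] is prime. *)
Definition ordp (p : nat) (x : m3) : bool :=
  meq (mexp x p) mat1 && ~~ meq x mat1.

Definition ord4 (x : m3) : bool :=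
  meq (mexp x 4) mat1 && ~~ meq (mexp x 2) mat1.

(* For x of order 7: y normalizes the group generated by x. *)
Definition normz (x : m3) : m3 -> bool :=
  let ps := [seq mexp x k | k <- iota 0 7] in
  fun y => let z := mmul x y in has (fun p => meq z (mmul y p)) ps.

Definition fixes (v : v3) (x : m3) : bool := veq (vmul v x) v.

(* Junk value v0 if x fixes no nonzero vector. *)
Definition fixpt (x : m3) : v3 :=
  nth v0 points (find (fun v => fixes v x) points).

(** A line is given by the coordinates of the one nonzero functional vanishing on it; [x] preserves
    the line iff its transpose fixes that vector. *)
Definition fixln (x : m3) : v3 := fixpt (tr3 x).

Fixpoint combs (n : nat) (s : seq v3) : seq (seq v3) :=
  match n, s with
  | 0, _ => [:: [::]]
  | _, [::] => [::]
  | n'.+1, v :: s' => [seq v :: t | t <- combs n' s'] ++ combs n s'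
  end.

(** The companion matrix of the primitive polynomial X^3 + X + 1, a Singer cycle. *)
Definition a7 : m3 :=
  ((false, true, false), (false, false, true), (true, true, false)).

Definition transvection : m3 :=
  ((true, false, false), (false, true, true), (false, false, true)).

(** This is 21 times the number of Sylow 7-subgroups normalized by [g], since each of the 8 is the
    conjugate of the group of [a7] by 21 elements [h]. *)
Definition bad_count (g : m3) : nat :=
  count (fun h => normz a7 (mmul (mmul h g) (minv h))) gl3.

Definition a7_words (y : m3) : seq m3 :=
  [seq mmul (mexp a7 k) y | k <- iota 0 7].

(** For [s] of order 4 and [g] of order 3 the last word is the commutator s g s^-1 g^-1. *)
Definition words (s g : m3) : seq m3 :=
  let g2 := mmul g g in let s2 := mmul s s in
  [:: mmul s g; mmul s g2; mmul s2 g; mmul (mmul s g) (mmul (mmul s s2) g2)].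

(* Elements of order 3; the pairs of Sylow 7-subgroups that they normalize form
   a perfect matching of the 8 Sylow 7-subgroups. *)
Definition matching : seq m3 :=
  [:: ((false, false, true), (true, false, false), (false, true, false));
      ((false, false, true), (false, true, false), (true, true, true));
      ((false, false, true), (true, true, true), (false, true, true));
      ((false, false, true), (true, false, true), (true, true, false))].

(* The axes of these transvections cover all the points. *)
Definition concurrent : seq m3 :=
  [:: ((false, false, true), (false, true, false), (true, false, false));
      ((false, false, true), (true, true, true), (true, false, false));
      transvection].

Definition share_fixpt (x y : m3) : bool :=
  has (fun v => fixes v x && fixes v y) points.

Definition nonid (x : m3) : bool := has (meq x) gl3 && ~~ meq x mat1.

Lemma veqP v w : reflect (v = w) (veq v w).
Proof.
move: v w => [[a b] c] [[a' b'] c']; apply: (iffP and3P) => [[]|[-> -> ->]].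
  by do 3!move/eqP->.
by split; apply/eqP.
Qed.

Lemma meqP x y : reflect (x = y) (meq x y).
Proof.
move: x y => [[a b] c] [[a' b'] c']; apply: (iffP and3P) => [[]|[-> -> ->]].
  by do 3!move/veqP->.
by split; apply/veqP.
Qed.

(** * Finite verifications *)

Lemma gl3_inv : all (fun x => meq (mmul x (minv x)) mat1) gl3.
Proof. by vm_compute. Qed.

Lemma size_gl3 : size gl3 = 168%N.
Proof. by vm_compute. Qed.

(** The identity, 56 elements of order 3 and 48 of order 7: more than half of the group. *)
Lemma count_odd_order : count (fun x => meq (mexp x 21) mat1) gl3 = 105%N.
Proof. by vm_compute. Qed.

Lemma a7_normz_words : all (fun y => normz a7 y ||
  has (ordp 3) (a7_words y) && has ord4 (a7_words y)) gl3.
Proof. by vm_compute. Qed.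

Lemma ord4_ord3_words :
  all (fun s => ord4 s ==> all (fun g => ordp 3 g ==>
    [|| veq (fixpt s) (fixpt g), veq (fixln s) (fixln g) |
        has (ordp 7) (words s g)]) gl3) gl3.
Proof. by vm_compute. Qed.

Lemma bad_count_leq :
  all (fun g => meq g mat1 ||
    ((bad_count g <= 42) && (ordp 3 g || (bad_count g <= 21))))%N gl3.
Proof. by vm_compute. Qed.

Lemma bad_count_max : bad_count (head mat1 matching) = 42%N.
Proof. by vm_compute. Qed.

Lemma count_normz_a7 : count (normz a7) gl3 = 21%N.
Proof. by vm_compute. Qed.

Lemma count_commute_a7 : count (fun x => meq (mmul x a7) (mmul a7 x)) gl3 = 7%N.
Proof. by vm_compute. Qed.

Lemma ord7_or_fixpt : all (fun x => ordp 7 x || has (fun v => fixes v x) points) gl3.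
Proof. by vm_compute. Qed.

Lemma points_moved : all (fun v => has (fun x => ~~ fixes v x) gl3) points.
Proof. by vm_compute. Qed.

(** Each point is sent to each of the 3 points of the axis by 168 / 7 = 24 elements. *)
Lemma count_to_axis :
  all (fun v => count (fun h => fixes (vmul v h) transvection) gl3 == 72%N) points.
Proof. by vm_compute. Qed.

Lemma ord7_matching :
  all (fun s => ordp 7 s ==> has (normz s) matching) gl3.
Proof. by vm_compute. Qed.

(** The four elements of [matching] fix exactly the four points off the axis of [transvection], so
    the five cover all points. *)
Lemma not_ord7_matching :
  all (fun s => ordp 7 s || has (share_fixpt s) (rcons matching transvection)) gl3.
Proof. by vm_compute. Qed.

Lemma not_ord7_concurrent :
  all (fun s => ordp 7 s || has (share_fixpt s) concurrent) gl3.
Proof. by vm_compute. Qed.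

(** This rules out the junk value [v0] for the fixed point and the fixed line. *)
Lemma ord3_fix : all (fun g => ordp 3 g ==>
  has (veq (fixpt g)) points && has (veq (fixln g)) points) gl3.
Proof. by vm_compute. Qed.

Lemma avoid_four : all (fun p => all (fun q => all (fun r => all (fun s =>
  has (all (fun v => ~~ [|| veq p v, veq q v, veq r v | veq s v])) (combs 3 points))
  points) points) points) points.
Proof. by vm_compute. Qed.

(** Three lines cover at least six of the seven points, so one of them meets any given three points;
    every flag is the fixed flag of some element of order 4. *)
Lemma flag_exists :
  let flags := [seq (fixpt s, fixln s) | s <- gl3 & ord4 s] in
  all (fun ps => all (fun ls =>
    has (fun f => has (veq f.1) ps && has (veq f.2) ls) flags)
    (combs 3 points)) (combs 3 points).
Proof. by vm_compute. Qed.

Lemma ord_a7 : ordp 7 a7. Proof. by []. Qed.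

(** * Encoding of GL(3,2) *)

Lemma vmulA v x y : vmul (vmul v x) y = vmul v (mmul x y).
Proof.
(* In the ring of booleans [+] is xor and [*] is conjunction. *)
have dotA (a b c d e f g h i j k l m n o : bool) :
  (a * d + b * e + c * f) * m + (a * g + b * h + c * i) * n
    + (a * j + b * k + c * l) * o =
  a * (d * m + g * n + j * o) + b * (e * m + h * n + k * o)
    + c * (f * m + i * n + l * o) by ring.
move: v x y => [[a b] c] [[[[x00 x01] x02] [[x10 x11] x12]] [[x20 x21] x22]].
move=> [[[[y00 y01] y02] [[y10 y11] y12]] [[y20 y21] y22]] /=.
by congr (_, _, _); apply: dotA.
Qed.

(* Hides the matrix structure from unification. *)
Definition GL : finGroupType := {'GL_3(2)}.

Definition bit (x : 'F_2) : bool := x != 0.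

Lemma bitD x y : bit (x + y) = bit x (+) bit y.
Proof. by move: x y; do 2![case=> [[|[|[]]]] //= ?]. Qed.

Lemma bitM x y : bit (x * y) = bit x && bit y.
Proof. by move: x y; do 2![case=> [[|[|[]]]] //= ?]. Qed.

Lemma bit_inj : injective bit.
Proof. by do 2![case=> [[|[|[]]]] //= ?] => _; apply/val_inj. Qed.

Definition row3 (A : 'M['F_2]_3) (i : 'I_3) : v3 :=
  (bit (A i 0), bit (A i 1), bit (A i (1 + 1))).

Definition enc (u : GL) : m3 :=
  (row3 (GLval u) 0, row3 (GLval u) 1, row3 (GLval u) (1 + 1)).

Lemma sum3 (F : 'I_3 -> 'F_2) : \sum_k F k = F 0 + F 1 + F (1 + 1).
Proof.
rewrite !big_ord_recl big_ord0 addr0 addrA.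
by congr (F _ + F _ + F _); apply: val_inj.
Qed.

Lemma I3_ind (Q : 'I_3 -> Prop) : Q 0 -> Q 1 -> Q (1 + 1) -> forall i, Q i.
Proof.
move=> Q0 Q1 Q2 [[|[|[|//]]] lti].
- by have <-: 0 = Ordinal lti by apply: val_inj.
- by have <-: 1 = Ordinal lti by apply: val_inj.
by have <-: 1 + 1 = Ordinal lti by apply: val_inj.
Qed.

Lemma encM u v : enc (u * v)%g = mmul (enc u) (enc v).
Proof.
have rowM i : row3 (GLval (u * v)%g) i = vmul (row3 (GLval u) i) (enc v).
  by rewrite /row3 /= !mxE !sum3 !bitD !bitM.
by rewrite /enc !rowM.
Qed.

Lemma enc1 : enc 1%g = mat1.
Proof. by rewrite /enc GL_1E /row3 !mxE. Qed.

Lemma enc_inj : injective enc.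
Proof.
move=> u v [] *; apply/val_inj/matrixP.
by apply: I3_ind; apply: I3_ind; apply: bit_inj.
Qed.

Lemma encX u n : enc (u ^+ n)%g = mexp (enc u) n.
Proof. by elim: n => [|n IHn]; rewrite ?enc1 // expgS encM IHn. Qed.

Lemma enc_meq u v : meq (enc u) (enc v) = (u == v).
Proof. by apply/meqP/eqP => [/enc_inj | ->]. Qed.

Lemma vmul1 v : vmul v mat1 = v.
Proof. by case: v => [[[] []] []]. Qed.

Lemma v0mul x : vmul v0 x = v0.
Proof. by move: x => [[[[a b] c] [[d e] f]] [[g h] i]]. Qed.

Lemma mem_mats x : x \in mats.
Proof.
have vP (v : v3) : v \in v0 :: points by case: v => [[[] []] []].
case: x => [[a b] c]; apply/allpairsP; exists ((a, b), c); split=> //.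
by apply/allpairsP; exists (a, b).
Qed.

Lemma enc_gl3 u : enc u \in gl3.
Proof.
rewrite mem_filter mem_mats andbT; apply/allP=> v.
apply: contraTN => /veqP v0u; rewrite -(vmul1 v) -enc1 -(mulgV u) encM -vmulA v0u.
by rewrite v0mul.
Qed.

Lemma forall_enc (Q : pred m3) : all Q gl3 -> forall u, Q (enc u).
Proof. by move/allP=> Qgl u; apply/Qgl/enc_gl3. Qed.

Lemma encV u : enc u^-1%g = minv (enc u).
Proof.
have /meqP ui := forall_enc gl3_inv u.
have assoc x y z : mmul (mmul x y) z = mmul x (mmul y z).
  by case: x => [[a b] c] /=; rewrite !vmulA.
have mmul1 x : mmul x mat1 = x by case: x => [[a b] c] /=; rewrite !vmul1.
have mul1m x : mmul mat1 x = x.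
  by move: x => [[[[a b] c] [[d e] f]] [[g h] i]] /=; rewrite !addbF.
by rewrite -(mmul1 (enc u^-1%g)) -ui -assoc -encM mulVg enc1 mul1m.
Qed.

Lemma card_GL32 : #|[set: GL]| = 168%N.
Proof.
by rewrite card_GL // card_Fp // unlock.
Qed.

(** An injection between lists of the same length 168. This turns counts over [gl3] into
    cardinalities in the group. *)
Lemma enc_gl3_perm : perm_eq [seq enc u | u <- enum {: GL}] gl3.
Proof.
have uniq_enc : uniq [seq enc u | u <- enum {: GL}].
  by rewrite map_inj_uniq ?enum_uniq //; apply: enc_inj.
have sub_gl3 : {subset [seq enc u | u <- enum {: GL}] <= gl3}.
  by move=> x /mapP[u _ ->]; apply: enc_gl3.
have [|eqi eqs] := uniq_min_size uniq_enc sub_gl3.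
  by rewrite size_map -cardE -cardsT card_GL32 size_gl3.
by rewrite uniq_perm // -(eq_uniq eqs).
Qed.

Lemma enc_onto x : x \in gl3 -> exists u, enc u = x.
Proof. by rewrite -(perm_mem enc_gl3_perm) => /mapP[u _ ->]; exists u. Qed.

Lemma card_enc (Q : pred m3) : #|[set u : GL | Q (enc u)]| = count Q gl3.
Proof.
rewrite -(seq.permP enc_gl3_perm) count_map -size_filter cardsE cardE.
by rewrite enumT; congr (size _); apply: eq_filter => u; rewrite !inE.
Qed.

(** * Subgroups of L_3(2) *)

Lemma conjVgE (gT : finGroupType) (g x : gT) : (g ^ x^-1 = x * g * x^-1)%g.
Proof. by rewrite conjgE invgK mulgA. Qed.

Lemma L32_setT : L32 = [set: GL]%G.
Proof.
apply/val_inj/setP=> u /=; rewrite !inE.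
have : \det (GLval u) != 0 by have := GL_unitmx u; rewrite unitmxE unitfE.
by case: (\det _) => [[|[|[]]]].
Qed.

Lemma enc_ordp p u : prime p -> ordp p (enc u) = (#[u]%g == p).
Proof.
move=> p_pr; rewrite /ordp -encX -enc1 !enc_meq -order_dvdn -order_eq1.
apply/andP/eqP => [[/(prime_nt_dvdP p_pr) def_p /def_p //] | ->].
by rewrite dvdnn; case: p p_pr => [|[]].
Qed.

Lemma ord4_dvdn u : ord4 (enc u) -> (4 %| #[u]%g)%N.
Proof.
rewrite /ord4 -!encX -enc1 !enc_meq -!order_dvdn => /andP[].
rewrite (_ : 4 = 2 ^ 2)%N // => /(dvdn_pfactor _ _ (isT : prime 2))[m lem ->].
by move: m lem => [|[|[]]].
Qed.

(** Otherwise [M] has index 2 and contains all squares, among them every [u] with u^21 = 1, as then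
    u = (u^11)^2. There are 105 > 84 of these. *)
Lemma full_of_dvdn_card (M : {group GL}) : (84 %| #|M|)%N -> M :=: [set: GL].
Proof.
move=> dvd84; have := cardSg (subsetT M); rewrite card_GL32 => dvdM.
apply/eqP; rewrite eqEcard subsetT card_GL32 /=.
have M_gt0 := cardG_gt0 M.
have [k defM] := dvdnP dvd84.
have k_gt0 : (0 < k)%N by case: k defM M_gt0 => [->|].
rewrite defM leqNgt; apply/negP => ltk.
have k1 : k = 1%N.
  apply/eqP; rewrite eqn_leq k_gt0 andbT -ltnS.
  by rewrite -(ltn_pmul2r (isT : 0 < 84)%N).
have cardM : #|M| = 84%N by rewrite defM k1.
have nM : M <| [set: GL].
  by rewrite index2_normal ?subsetT // -divgS ?subsetT // card_GL32 cardM.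
have sqM u : (u ^+ 2)%g \in M.
  have Nu : u \in 'N(M) by rewrite (subsetP (normal_norm nM)) ?inE.
  have cardQ : #|([set: GL] / M)%g| = 2%N.
    by rewrite card_quotient ?normal_norm // -divgS ?subsetT // card_GL32 cardM.
  apply: coset_idr; rewrite ?groupX // morphX //= -cardQ.
  by rewrite expg_cardG // mem_quotient ?inE.
suff : (105 <= #|M|)%N by rewrite cardM.
rewrite -count_odd_order -card_enc subset_leq_card //; apply/subsetP=> u.
rewrite inE -encX -enc1 enc_meq => /eqP u21.
have -> : u = ((u ^+ 11) ^+ 2)%g.
  by rewrite -expgM (_ : (11 * 2 = 21.+1)%N) // expgS u21 mulg1.
exact: sqM.
Qed.

Lemma full_of_orders (M : {group GL}) u v w :
  u \in M -> ordp 7 (enc u) -> v \in M -> ordp 3 (enc v) ->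
  w \in M -> ord4 (enc w) -> M :=: [set: GL].
Proof.
move=> Mu; rewrite enc_ordp // => /eqP u7 Mv; rewrite enc_ordp // => /eqP v3.
move=> Mw /ord4_dvdn w4; apply: full_of_dvdn_card.
rewrite (_ : 84 = 7 * 3 * 4)%N // !Gauss_dvd // -{1}u7 -{1}v3 !order_dvdG //=.
exact: dvdn_trans w4 (order_dvdG Mw).
Qed.

Lemma norm_normz (u : GL) y : #[u]%g = 7%N -> (y \in 'N(<[u]>)) = normz (enc u) (enc y).
Proof.
move=> u7; rewrite inE -cycleJ cycle_subG; apply/cycleP/hasP.
  case=> i ui; exists (enc (u ^+ i)).
    apply/mapP; exists (i %% 7)%N; first by rewrite mem_iota /= ltn_mod.
    by rewrite -encX -u7 expg_mod_order.
  by rewrite -!encM enc_meq -ui -conjgC.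
case=> p /mapP[i _ ->]; rewrite -!encX -!encM enc_meq => /eqP uy.
by exists i; rewrite conjgE uy mulKg.
Qed.

Lemma exists_a7 : exists2 a, enc a = a7 & #[a]%g = 7%N.
Proof.
have [|a Ha] := enc_onto (_ : a7 \in gl3).
  by vm_compute.
by exists a => //; apply/eqP; rewrite -enc_ordp // Ha ord_a7.
Qed.

(** By Sylow's theorem; this transfers the computations with [a7] to every element of order 7. *)
Lemma cycles7_conj (s t : GL) : #[s]%g = 7%N -> #[t]%g = 7%N ->
  exists k, <[s]>%g = (<[t]> :^ k)%g.
Proof.
have syl (x : GL) : #[x]%g = 7%N -> 7.-Sylow([set: GL]) <[x]>%g.
  by move=> x7; rewrite pHallE subsetT /= -orderE x7 card_GL32 p_part.
move=> /syl sylS /syl sylT.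
by have [k _ ->] := Sylow_trans sylT sylS; exists k.
Qed.

Lemma norm_a7 (a y : GL) : enc a = a7 -> #[a]%g = 7%N ->
  (y \in 'N(<[a]>)) = normz a7 (enc y).
Proof. by move=> a_enc ?; rewrite norm_normz // a_enc. Qed.

Lemma full_or_norm_a7 (a : GL) (H : {group GL}) :
  enc a = a7 -> #[a]%g = 7%N -> a \in H ->
  H \subset 'N(<[a]>) \/ H :=: [set: GL].
Proof.
move=> a_enc ord_a Ha.
case: (boolP (H \subset 'N(<[a]>))) => [|/subsetPn[y Hy]]; first by left.
rewrite (norm_a7 _ a_enc ord_a) => Ny; right.
have words x : x \in a7_words (enc y) -> exists2 w, w \in H & x = enc w.
  case/mapP=> k _ ->; exists (a ^+ k * y)%g; first by rewrite groupM // groupX.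
  by rewrite encM encX a_enc.
case/orP: (forall_enc a7_normz_words y) => [Ny' | /andP[]].
  by rewrite Ny' in Ny.
case/hasP=> _ /words[v Hv ->] v3 /hasP[_ /words[w Hw ->] w4].
by apply: full_of_orders Ha _ Hv v3 Hw w4; rewrite a_enc.
Qed.

Lemma full_or_norm (s : GL) (H : {group GL}) : #[s]%g = 7%N -> s \in H ->
  H \subset 'N(<[s]>) \/ H :=: [set: GL].
Proof.
move=> s7 Hs; have [a a_enc ord_a] := exists_a7.
have [k defS] := cycles7_conj s7 ord_a.
have [|sHN|HT] := @full_or_norm_a7 a (H :^ k^-1)%G a_enc ord_a.
- by rewrite /= -cycle_subG -sub_conjg -defS cycle_subG.
- by left; rewrite defS normJ -sub_conjgV.
by right; rewrite -(conjsgKV k H) /= HT conjTg.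
Qed.

Lemma card_norm7 (s : GL) : #[s]%g = 7%N -> #|'N(<[s]>)| = 21%N.
Proof.
move=> s7; have [a a_enc ord_a] := exists_a7.
have [k ->] := cycles7_conj s7 ord_a.
rewrite normJ cardJg -count_normz_a7 -card_enc; apply: eq_card => y.
by rewrite inE -(norm_a7 _ a_enc ord_a).
Qed.

(** If [<[s]>] is the conjugate of [<[a]>] by [k], left translation by [k] maps the set for [s] onto
    the one counted for [a7]. *)
Lemma card_conj_into_norm7 (s g : GL) : #[s]%g = 7%N ->
  #|conj_into [set: GL]%G 'N(<[s]>)%G g| = bad_count (enc g).
Proof.
move=> s7; have [a a_enc ord_a] := exists_a7.
have [k ->] := cycles7_conj s7 ord_a.
have badE x : (x \in [set h : GL | normz a7 (mmul (mmul (enc h) (enc g)) (minv (enc h)))])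
    = ((g ^ x^-1)%g \in 'N(<[a]>)).
  by rewrite conjVgE (norm_a7 _ a_enc ord_a) [LHS]inE 2!encM encV.
have conj_intoE x : (x \in conj_into [set: GL]%G 'N(<[a]> :^ k)%G g)
    = ((g ^ (k * x)^-1)%g \in 'N(<[a]>)).
  by rewrite inE in_setT /= normJ mem_conjg -conjgM invMg.
rewrite /bad_count -card_enc -(card_imset _ (mulgI k)); apply: eq_card => h.
apply/imsetP/idP => [[x] | ].
  by rewrite conj_intoE => Nx ->; rewrite badE.
rewrite badE => Nh; exists (k^-1 * h)%g; last by rewrite mulKVg.
by rewrite conj_intoE mulKVg.
Qed.

Lemma norm7_proper (s : GL) : #[s]%g = 7%N -> 'N(<[s]>) \proper [set: GL].
Proof. by move=> s7; rewrite properEcard subsetT card_norm7 // card_GL32. Qed.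

Lemma maximals_ord7 (s : GL) : #[s]%g = 7%N ->
  maximals [set: GL]%G s = [set 'N(<[s]>)%G].
Proof.
move=> s7; have Ns : s \in 'N(<[s]>) by rewrite (subsetP (normG _)) ?cycle_id.
have sub_norm (H : {group GL}) : H \proper [set: GL] -> s \in H -> H \subset 'N(<[s]>).
  by move=> prH /(full_or_norm s7)[//|HT]; rewrite HT properxx in prH.
apply/setP=> M; rewrite inE in_set1; apply/andP/eqP => [[maxM Ms] | ->].
  have [prM /(_ 'N(<[s]>)%G (norm7_proper s7)) maxM'] := maxgroupP maxM.
  by apply/val_inj; rewrite /= maxM' ?sub_norm.
split=> //; apply/maxgroupP; split=> [|H prH sNH]; first exact: norm7_proper.
by apply/eqP; rewrite eqEsubset sNH andbT sub_norm ?(subsetP sNH).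
Qed.

Lemma card_cent7 (s : GL) : #[s]%g = 7%N -> #|'C(<[s]>)| = 7%N.
Proof.
move=> s7; have [a a_enc ord_a] := exists_a7.
have [k ->] := cycles7_conj s7 ord_a.
rewrite centJ cardJg -count_commute_a7 -card_enc; apply: eq_card => y.
by rewrite cent_cycle cent1E in_set -a_enc -!encM enc_meq.
Qed.

(** A Sylow 3-subgroup of the normalizer is a complement to [<[s]>]. The centralizer of [<[s]>] has
    order 7 only, so the normalizer is not abelian. *)
Lemma type_7_3_norm7 (s : GL) : #[s]%g = 7%N -> type_7_3 'N(<[s]>)%G.
Proof.
move=> s7; have [H sylH] := Sylow_exists 3 'N(<[s]>)%G.
have cardH : #|H| = 3%N by rewrite (card_Hall sylH) /= card_norm7 // p_part.
exists <[s]>%G, H; split=> //.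
  have [sHN _ _] := and3P sylH.
  have tiSH : <[s]> :&: H = 1%g.
    by rewrite coprime_TIg // cardH -orderE s7.
  rewrite sdprodE //=; apply/eqP; rewrite eqEcard mul_subG ?normG //=.
  by rewrite TI_cardMg // cardH -orderE s7 card_norm7.
apply/negP=> /= abN.
have : 'N(<[s]>) \subset 'C(<[s]>).
  by rewrite (subset_trans abN) // centS ?normG.
by move/subset_leq_card; rewrite card_norm7 // card_cent7.
Qed.

(** * Obstructions to generation *)

Lemma ngen_fix v (x y : GL) : v \in points ->
  fixes v (enc x) -> fixes v (enc y) -> <<[set x; y]>>%g != [set: GL].
Proof.
(* The stabilizer of [v] is a subgroup, and proper because some element moves [v]. *)
move=> pv vx vy; pose H := [set u : GL | fixes v (enc u)].
have gH : group_set H.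
  apply/group_setP; split=> [|u w]; rewrite !inE /fixes; first by rewrite enc1 vmul1; apply/veqP.
  by move=> /veqP vu /veqP vw; rewrite encM -vmulA vu vw; apply/veqP.
have /hasP[_ /enc_onto[w <-] nvw] := allP points_moved v pv.
apply: contra nvw => /eqP genT.
have : <<[set x; y]>>%g \subset Group gH by rewrite gen_subG subUset !sub1set !inE vx.
by rewrite genT => /subsetP/(_ w (in_setT _)); rewrite inE.
Qed.

Lemma ngen_share (x y : GL) :
  share_fixpt (enc x) (enc y) -> <<[set x; y]>>%g != [set: GL].
Proof. by case/hasP=> v pv /andP[]; apply: ngen_fix pv. Qed.

Lemma ngen_norm7 (s g : GL) : #[s]%g = 7%N -> g \in 'N(<[s]>) ->
  <<[set g; s]>>%g != [set: GL].
Proof.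
move=> s7 Ng; apply: contraTneq (norm7_proper s7) => genT; apply/negP => prN.
have: <<[set g; s]>>%g \subset 'N(<[s]>).
  by rewrite gen_subG subUset !sub1set Ng (subsetP (normG _)) ?cycle_id.
by rewrite genT => /(proper_sub_trans prN); rewrite properxx.
Qed.

Lemma enc_ord7 (s : GL) : ordp 7 (enc s) = (#[s]%g == 7%N).
Proof. exact: enc_ordp. Qed.

Lemma fixpt_of_not_ord7 (s : GL) : #[s]%g != 7%N ->
  exists2 v, v \in points & fixes v (enc s).
Proof.
have := forall_enc ord7_or_fixpt s; rewrite enc_ord7 => /orP[->|/hasP[v pv vs]] // _.
by exists v.
Qed.

Lemma card_bad_ord7 (s g : GL) : #[s]%g = 7%N ->
  #|bad_conj [set: GL]%G g s| = bad_count (enc g).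
Proof.
move=> s7; rewrite (bad_conj_maximals1 (maximals_ord7 s7)) ?in_setT //.
exact: card_conj_into_norm7.
Qed.

Lemma bad_count_le42 (g : GL) : g != 1%g -> (bad_count (enc g) <= 42)%N.
Proof.
move=> g1; have := forall_enc bad_count_leq g; rewrite -enc1 enc_meq (negPf g1).
by case/andP.
Qed.

Lemma bad_count_le21 (g : GL) : g != 1%g -> ~~ ordp 3 (enc g) -> (bad_count (enc g) <= 21)%N.
Proof.
move=> g1 g3; have := forall_enc bad_count_leq g; rewrite -enc1 enc_meq (negPf g1).
by case/andP=> _; rewrite (negPf g3).
Qed.

Lemma nonid_onto x : nonid x -> exists2 u : GL, enc u = x & u != 1%g.
Proof.
case/andP=> /hasP[_ /enc_onto[u <-] /meqP ->].
by rewrite -enc1 enc_meq; exists u.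
Qed.

(** * Values of sigma and P *)

Lemma ratio42 n : ((n%:R : rat) / 168%:R <= 1 / 4) = (n <= 42)%N.
Proof.
rewrite ler_pdivrMr // -(ler_nat rat); congr (_ <= _); lra.
Qed.

Lemma quarterE : (42%:R : rat) / 168%:R = 1 / 4.
Proof. lra. Qed.

Lemma P_gs_ord7 (g s : GL) : #[s]%g = 7%N ->
  P_gs [set: GL]%G g s = (bad_count (enc g))%:R / 168%:R.
Proof. by move=> s7; rewrite /P_gs -/(bad_conj _ _ _) card_bad_ord7 // card_GL32. Qed.

Lemma sigma_gs_ord7 (g s : GL) : #[s]%g = 7%N ->
  sigma_gs [set: GL]%G g s = (bad_count (enc g))%:R / 168%:R.
Proof.
move=> s7; rewrite (sigma_gs_maximals1 _ (maximals_ord7 s7)).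
by rewrite card_conj_into_norm7 // card_GL32.
Qed.

(** Serves P and sigma alike. The maximum is attained at an element of order 3, which normalizes two
    Sylow 7-subgroups. *)
Lemma max_ord7 F (s : GL) :
  (forall g : GL, F g = (bad_count (enc g))%:R / 168%:R) ->
  max_over [set: GL]%G^# F = 1 / 4.
Proof.
move=> FE; have [|g gE g1] := @nonid_onto (head mat1 matching); first by vm_compute.
apply: (max_over_eq (x := g)); first by rewrite !inE g1.
  by rewrite FE gE bad_count_max quarterE.
by move=> h /setD1P[h1 _]; rewrite FE ratio42 bad_count_le42.
Qed.

(* A transvection g: its axis contains 3 of the 7 points, and s fixes a point. *)
Lemma P_gs_not_ord7 (s : GL) : #[s]%g != 7%N ->
  exists2 g, g \in [set: GL]%G^# & 1 / 4 < P_gs [set: GL]%G g s.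
Proof.
move=> s7; have [v pv vs] := fixpt_of_not_ord7 s7.
have [|g gE g1] := @nonid_onto transvection; first by vm_compute.
exists g; first by rewrite !inE g1.
rewrite ltNge /P_gs -/(bad_conj _ _ _) card_GL32 ratio42 -ltnNge.
have /eqP card72 := allP count_to_axis v pv.
rewrite (@leq_trans 72) // -{1}card72 -card_enc subset_leq_card //.
apply/subsetP=> h; rewrite in_set -gE in_set => vhg /=.
have vh : vmul v (enc h) \in points.
  have : vmul v (enc h) \in v0 :: points by case: vmul => [[[] []] []].
  rewrite in_cons => /orP[/eqP v0h|//]; move: pv.
  by rewrite -(vmul1 v) -enc1 -(mulgV h) encM -vmulA v0h v0mul.
rewrite in_setT; apply: (ngen_fix vh) vhg.
(* Since [s] fixes v, its conjugate h^-1 s h fixes vh. *)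
apply/veqP; rewrite conjgE !encM !vmulA -!encM.
by rewrite mulVKg encM -vmulA; move/veqP: vs => ->.
Qed.

Lemma P_s_ord7 (s : GL) : #[s]%g = 7%N -> P_s [set: GL]%G s = 1 / 4.
Proof. by move=> s7; apply: (max_ord7 s) => g; apply: P_gs_ord7. Qed.

Lemma sigma_s_ord7 (s : GL) : #[s]%g = 7%N -> sigma_s [set: GL]%G s = 1 / 4.
Proof. by move=> s7; apply: (max_ord7 s) => g; apply: sigma_gs_ord7. Qed.

Lemma P_s_not_ord7 (s : GL) : #[s]%g != 7%N -> 1 / 4 < P_s [set: GL]%G s.
Proof.
move=> /P_gs_not_ord7[g Gg]; move/lt_le_trans; apply.
exact: (max_over_ge (fun g => P_gs [set: GL]%G g s)).
Qed.

Lemma sigma_s_not_ord7 (s : GL) : #[s]%g != 7%N -> 1 / 4 < sigma_s [set: GL]%G s.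
Proof.
move=> /P_gs_not_ord7[g Gg]; move/lt_le_trans; apply.
apply: le_trans (P_gs_le_sigma_gs (in_setT g) (in_setT s)) _.
exact: (max_over_ge (fun g => sigma_gs [set: GL]%G g s)).
Qed.

Lemma min_ord7 (F : GL -> rat) :
  (forall s : GL, #[s]%g = 7%N -> F s = 1 / 4) ->
  (forall s : GL, #[s]%g != 7%N -> 1 / 4 < F s) ->
  min_over [set: GL]%G^# F = 1 / 4 /\
  (forall s, s \in [set: GL]%G^# -> (F s = 1 / 4 <-> #[s]%g = 7%N)).
Proof.
move=> F7 Fn7; split; last first.
  move=> s _; split=> [Fs|]; last exact: F7.
  by apply/eqP; apply: contraPT Fs => /Fn7 lt Fs; rewrite Fs ltxx in lt.
have [a _ a7] := exists_a7; apply: (min_over_eq (x := a)); last 1 first.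
- by move=> s _; have [/F7-> | /Fn7/ltW] := eqVneq #[s]%g 7%N; rewrite ?lexx.
- by rewrite !inE andbT -order_eq1 a7.
exact: F7.
Qed.

(** * Spread and uniform spread *)

Lemma spread3_ord7 (s : GL) : #[s]%g = 7%N ->
  spread_from [set: GL]%G (s ^: [set: GL]%G) 3.
Proof.
move=> s7 g g1; have [|h _ hgen] := @conj_generates _ [set: GL]%G 3 g s.
  (* Three bad sets of size at most 42 cover at most 126 < 168 elements. *)
  rewrite card_GL32 (@leq_ltn_trans (\sum_(i < 3) 42)) //; last first.
    by rewrite sum_nat_const card_ord.
  by apply: leq_sum => i _; rewrite card_bad_ord7 // bad_count_le42 //; case/setD1P: (g1 i).
by exists (s ^ h)%g; rewrite ?memJ_class ?in_setT.
Qed.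

(** Pulls an explicit list of matrices back to a tuple of group elements, indexed by position, that
    refutes spread. *)
Lemma not_spread_from (xs : seq m3) (A : {set GL}) :
  all nonid xs ->
  (forall s, s \in A -> exists2 x, x \in xs &
     forall g : GL, enc g = x -> <<[set g; s]>>%g != [set: GL]) ->
  ~ spread_from [set: GL]%G A (size xs).
Proof.
move=> /allP nonid_xs ngen spr.
have /fin_all_exists[g gP] (i : 'I_(size xs)) :
    exists u : GL, enc u = nth mat1 xs i /\ u != 1%g.
  by have [u] := nonid_onto (nonid_xs _ (mem_nth mat1 (ltn_ord i))); exists u.
have [|s As gen] := spr g; first by move=> i; have [_ g1] := gP i; rewrite !inE g1.
have [x xs_x ngen_x] := ngen s As.
have ltx : (index x xs < size xs)%N by rewrite index_mem.
have gx : enc (g (Ordinal ltx)) = x.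
  by have [-> _] := gP (Ordinal ltx); rewrite nth_index.
by have := ngen_x _ gx; rewrite gen eqxx.
Qed.

Lemma not_uniform_spread4 (C : {set GL}) :
  C \in classes [set: GL] -> ~ spread_from [set: GL]%G C 4.
Proof.
case/imsetP=> s _ ->; have [s7 | s7] := eqVneq #[s]%g 7%N.
  apply: (@not_spread_from matching) => [|_ /imsetP[h _ ->]].
    by vm_compute.
  have : #[s ^ h]%g = 7%N by rewrite orderJ.
  move: (s ^ h)%g => t t7; have := forall_enc ord7_matching t;
  rewrite enc_ord7 t7 eqxx => /hasP[x xm Nx].
  by exists x => // g gE; apply: ngen_norm7 => //; rewrite norm_normz // gE.
(* Three transvections are enough; one is repeated to reach length 4, as the g_i may coincide. *)
apply: (@not_spread_from (rcons concurrent transvection)) => [|_ /imsetP[h _ ->]].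
  by vm_compute.
have : #[s ^ h]%g != 7%N by rewrite orderJ.
move: (s ^ h)%g => t t7; have := forall_enc not_ord7_concurrent t.
rewrite enc_ord7 (negPf t7) => /hasP[x xm Nx].
exists x => [|g gE]; first by rewrite mem_rcons in_cons xm orbT.
by rewrite setUC; apply: ngen_share; rewrite gE.
Qed.

Lemma not_spread5 : ~ spread_from [set: GL]%G [set: GL]%G 5.
Proof.
apply: (@not_spread_from (rcons matching transvection)) => [|s _].
  by vm_compute.
have [s7 | s7] := eqVneq #[s]%g 7%N.
  have := forall_enc ord7_matching s; rewrite enc_ord7 s7 eqxx => /hasP[x xm Nx].
  exists x => [|g gE]; first by rewrite mem_rcons in_cons xm orbT.
  by apply: ngen_norm7 => //; rewrite norm_normz // gE.
have := forall_enc not_ord7_matching s; rewrite enc_ord7 (negPf s7) => /hasP[x xm Nx].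
by exists x => // g gE; rewrite setUC; apply: ngen_share; rewrite gE.
Qed.

Lemma gen_ord4_ord3 (s g : GL) : ord4 (enc s) -> ordp 3 (enc g) ->
  fixpt (enc s) != fixpt (enc g) -> fixln (enc s) != fixln (enc g) ->
  <<[set g; s]>>%g = [set: GL].
Proof.
move=> s4 g3 nept neln.
have Gs : s \in <<[set g; s]>>%g by rewrite mem_gen ?set22.
have Gg : g \in <<[set g; s]>>%g by rewrite mem_gen ?set21.
have [w Gw w7] : exists2 w, w \in <<[set g; s]>>%g & ordp 7 (enc w).
  have /implyP/(_ s4)/allP/(_ _ (enc_gl3 g)) := forall_enc ord4_ord3_words s.
  rewrite g3 => /or3P[/veqP e|/veqP e|/hasP[x xw x7]].
  - by rewrite e eqxx in nept.
  - by rewrite e eqxx in neln.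
  have wordsE : words (enc s) (enc g) = [seq enc w | w <-
      [:: s * g; s * (g * g); s * s * g; s * g * (s * (s * s) * (g * g))]%g].
    by rewrite !map_cons !encM.
  rewrite wordsE in xw; have [w ws xE] := mapP xw.
  exists w; last by rewrite -xE.
  move: w ws {xE}; apply/allP.
  by rewrite /= !groupM.
exact: full_of_orders Gw w7 Gg g3 Gs s4.
Qed.

Lemma spread4_ord3 (g : 'I_4 -> GL) : (forall i, ordp 3 (enc (g i))) ->
  exists s, forall i, <<[set g i; s]>>%g = [set: GL].
Proof.
move=> g3.
have avoid (f : 'I_4 -> v3) : (forall i, f i \in points) ->
    exists2 t, t \in combs 3 points & forall i v, v \in t -> v != f i.
  (* Indexing by naturals lets a case analysis on [i] match the four arguments of [avoid_four]. *)
  move=> fpt; pose f' n := f (inord n).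
  have /hasP[t tc /allP tP] :=
    allP (allP (allP (allP avoid_four (f' 0) (fpt _))
      (f' 1) (fpt _)) (f' 2) (fpt _)) (f' 3) (fpt _).
  exists t => // i v /tP; rewrite eq_sym -[f i]/(f i) -(inord_val i).
  rewrite -[f (inord i)]/(f' i) => ntv; apply: contra ntv => /eqP/veqP.
  by case: i => [[|[|[|[]]]] ?] //= ->; rewrite ?orbT.
have fixP i : fixpt (enc (g i)) \in points /\ fixln (enc (g i)) \in points.
  have /implyP/(_ (g3 i))/andP[/hasP[v pv /veqP->] /hasP[w pw /veqP->]] :=
    forall_enc ord3_fix (g i).
  by [].
have [ps psc psP] := avoid _ (fun i => proj1 (fixP i)).
have [ls lsc lsP] := avoid _ (fun i => proj2 (fixP i)).
have /hasP[f /mapP[x]] := allP (allP flag_exists _ psc) _ lsc.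
rewrite mem_filter => /andP[x4 /enc_onto[s sE]] -> /andP[/hasP[p pps /veqP pE] /hasP[l lls /veqP lE]].
exists s => i; apply: gen_ord4_ord3; rewrite ?sE //.
  by rewrite -[fixpt x]/((fixpt x, fixln x).1) pE psP.
by rewrite -[fixln x]/((fixpt x, fixln x).2) lE lsP.
Qed.

Lemma spread4 : spread_from [set: GL]%G [set: GL]%G 4.
Proof.
move=> g g1; have [/forallP g3 | ] := boolP [forall i, ordp 3 (enc (g i))].
  by have [s sP] := spread4_ord3 g3; exists s; rewrite ?in_setT.
rewrite negb_forall => /existsP[j nj]; have [a _ a7] := exists_a7.
have [|h _ hgen] := @conj_generates _ [set: GL]%G 4 g a; last by exists (a ^ h)%g.
have gn1 i : g i != 1%g by case/setD1P: (g1 i).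
(* The element [g j], not of order 3, spoils at most 21 conjugators, and 21 + 3 * 42 = 147 < 168. *)
rewrite card_GL32 (bigD1 j) //= (@leq_ltn_trans (21 + \sum_(i < 4 | i != j) 42)) //; last first.
  by rewrite sum_nat_const cardC1 card_ord.
apply: leq_add; first by rewrite card_bad_ord7 // bad_count_le21.
by apply: leq_sum => i _; rewrite card_bad_ord7 // bad_count_le42.
Qed.

Theorem mainTheorem7 :
  [/\ (* (a) *)
      sigma L32 = 1 / 4 /\
      (forall s, s \in L32^# -> (sigma_s L32 s = 1 / 4 <-> #[s]%g = 7%N)),
      (* (b) *)
      forall s, s \in L32 -> #[s]%g = 7%N ->
        exists2 M, maximals L32 s = [set M] & type_7_3 M,
      (* (c) *)
      P L32 = 1 / 4 /\
      (forall s, s \in L32^# -> (P_s L32 s = 1 / 4 <-> #[s]%g = 7%N))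
    & (* (d) *)
      [/\ uniform_spread_eq L32 3,
          forall s, s \in L32 -> #[s]%g = 7%N -> spread_from L32 (s ^: L32) 3
        & spread_eq L32 4]].
Proof.
rewrite L32_setT; split.
- exact: min_ord7 sigma_s_ord7 sigma_s_not_ord7.
- by move=> s _ s7; exists 'N(<[s]>)%G; [exact: maximals_ord7 | exact: type_7_3_norm7].
- exact: min_ord7 P_s_ord7 P_s_not_ord7.
split.
- split=> [|[C]]; last exact: not_uniform_spread4.
  have [a _ a7] := exists_a7; exists (a ^: [set: GL])%g; last exact: spread3_ord7.
  by rewrite mem_classes ?in_setT.
- by move=> s _; apply: spread3_ord7.
by split; [exact: spread4 | exact: not_spread5].
Qed.
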